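(* If $T$ is a caterpillar having at least two vertices, then $$g(T)=p(T)+\ell(T)-1,$$ where $g(T)$ is the $P_3$-geodetic number of $T$, $\ell(T)$ is the number of leaves of $T$, and $p(T)$ is the basic sequence number of $T$.
   Context: Graphs are finite, simple and undirected. $d_T(v)$ is the degree of $v$. A pendant vertex (leaf) is a vertex of degree $1$. A caterpillar is a tree such that the removal of all its pendant vertices yields a path (possibly with one or no vertices). A $P_3$-geodetic set of a graph $G$ is a set $S\subseteq V(G)$ such that every vertex of $V(G)\setminus S$ has at least two neighbors in $S$; $g(G)$ is the minimum cardinality of a $P_3$-geodetic set. Reduced degree sequence: a dominating path of a graph is a path whose vertex set is a dominating set (every vertex outside it has a neighbor in it). A caterpillar $T$ with at least two vertices has a dominating path $P=v_1,\ldots,v_k$ whose endpoints are leaves of $T$. Put $\tilde d_T(w)=\min\{d_T(w),4\}$. The sequence $s(T)=\tilde d_T(v_1)\tilde d_T(v_2)\cdots\tilde d_T(v_k)$ is called a reduced degree sequence of $T$; it is unique up to reversal. Its first and last terms equal $1$. Basic sequences: let $\Gamma$ be the family of (possibly empty) finite sequences all of whose terms equal $4$. A basic sequence is a sequence that is either one of $1,\ 21,\ 22,\ 23,\ 24$ (each read as a sequence of digits), or one of $x\gamma1$, $x\gamma2$, $x\gamma31$, $x\gamma32$, $x\gamma33$, $x\gamma34$ for some $x\in\{3,4\}$ and some $\gamma\in\Gamma$ (juxtaposition denotes concatenation). $\Lambda$ is the family of all basic sequences. For every reduced degree sequence $s(T)$ there are a unique integer $p\ge1$ and unique $\lambda^1,\ldots,\lambda^p\in\Lambda$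 with $s(T)=1\lambda^1\lambda^2\cdots\lambda^p$; this $p$ is the basic sequence number $p(T)$ (computed from either of the two possible reduced degree sequences). *)

(* Defs.v *)
From mathcomp Require Import all_boot.
From Stdlib Require Import ClassicalEpsilon.

Set Implicit Arguments.
Unset Strict Implicit.
Unset Printing Implicit Defensive.

(* A finite simple graph is a symmetric irreflexive relation [e] on a finite
   type [V]; these two hypotheses are stated where the graph is introduced. *)

Section Graphs.
Variables (V : finType) (e : rel V).

Definition deg (v : V) : nat := #|[set u | e v u]|.

Definition leaves : {set V} := [set v | deg v == 1].

(* [ucycle e c] also holds when [c] lists the two ends of an edge, so only
   lists of length at least 3 are cycles of the graph. *)
Definition is_tree : Prop :=
  [/\ 0 < #|V|,
      forall x y : V, connect e x y &
      forall c : seq V, ucycle e c -> size c < 3].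

(* The subgraph induced by [A] is a path, possibly with one or no vertices. *)
Definition induces_path (A : {set V}) : Prop :=
  exists q : seq V,
    [/\ uniq q, q =i A &
        {in A &, forall x y, e x y =
           (index y q == (index x q).+1) || (index x q == (index y q).+1)}].

Definition caterpillar : Prop := is_tree /\ induces_path (~: leaves).

Definition P3_geodetic (S : {set V}) : bool :=
  [forall v, (v \notin S) ==> (2 <= #|[set u in S | e v u]|)].

Definition P3_geodetic_number : nat :=
  #|[arg min_(S < [set: V] | P3_geodetic S) #|S| ]|.

Definition dominating (P : seq V) : Prop :=
  forall v, v \notin P -> exists2 u, u \in P & e v u.

(* The path [v :: P] has two distinct endpoints: a single end of [K_2] is a
   dominating set, but it is not a path between leaves in the intended sense
   (the reduced degree sequence of [K_2] is [11]). *)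
Definition leaf_dominating_path (v : V) (P : seq V) : Prop :=
  [/\ path e v P && uniq (v :: P), 0 < size P,
      v \in leaves, last v P \in leaves & dominating (v :: P)].

Definition reduced_degree_sequence (s : seq nat) : Prop :=
  exists v P, leaf_dominating_path v P /\
    s = [seq minn (deg w) 4 | w <- v :: P].

End Graphs.

Definition basic_sequence (s : seq nat) : Prop :=
  s \in [:: [:: 1]; [:: 2; 1]; [:: 2; 2]; [:: 2; 3]; [:: 2; 4]]
  \/ exists x gamma t,
       [/\ x \in [:: 3; 4], all (pred1 4) gamma,
           t \in [:: [:: 1]; [:: 2]; [:: 3; 1]; [:: 3; 2]; [:: 3; 3]; [:: 3; 4]]
         & s = x :: gamma ++ t].

Definition basic_decomposition (s : seq nat) (lambda : seq (seq nat)) : Prop :=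
  (forall l, l \in lambda -> basic_sequence l) /\ s = 1 :: flatten lambda.

(* [p] is the number of basic sequences in every decomposition of every
   reduced degree sequence of the graph, and there is such a decomposition. *)
Definition is_basic_sequence_number (V : finType) (e : rel V) (p : nat) : Prop :=
  (exists s lambda,
     reduced_degree_sequence e s /\ basic_decomposition s lambda)
  /\ forall s lambda,
       reduced_degree_sequence e s -> basic_decomposition s lambda ->
       size lambda = p.

(* Junk value if there is no [p] as above; for a caterpillar with at least two
   vertices there is one, and it is unique by [basic_sequence_number_eq]. *)
Definition basic_sequence_number (V : finType) (e : rel V) : nat :=
  epsilon (inhabits 0) (is_basic_sequence_number e).

Lemma basic_sequence_number_eq (V : finType) (e : rel V) (p : nat) :
  is_basic_sequence_number e p -> basic_sequence_number e = p.
Proof.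
move=> hp; have [_ h] : is_basic_sequence_number e (basic_sequence_number e).
  by apply: epsilon_spec; exists p.
by case: hp => -[s [lambda [hs hl]]] h'; rewrite -(h _ _ hs hl) (h' _ _ hs hl).
Qed.

(* Main.v *)
Require Import Defs.
From mathcomp Require Import all_boot.
From mathcomp Require Import zify.

Set Implicit Arguments.
Unset Strict Implicit.
Unset Printing Implicit Defensive.

(** A leaf outside a P3-geodetic set would need two neighbours in it, so every
P3-geodetic set contains all the leaves.  Fix a dominating path v :: P between
two leaves.  Acyclicity forces every vertex off the path to be a leaf
([off_path_leaf]) and the path to be chordless
([interior_neighbour_on_path]).  So the only freedom is in the choice of the
selected interior vertices of the path, and whether an unselected interior
vertex is served depends only on its degree and on its two path neighbours:
degree 2 needs both of them selected, degree 3 needs one, degree at least 4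
needs none, because two pendant neighbours suffice.  This is the predicate
[valid] on words of reduced degrees decorated with selection bits; it is
equivalent to being P3-geodetic by [geodetic_valid] and [valid_geodetic].

The basic sequences are the blocks cut out by the greedy selection, which
postpones each choice as long as possible.  Every block contains a selected
position whatever happens outside of it ([block_has_selected]), so at least p
positions of P are selected ([flatten_leq_selected]).  Conversely, selecting
exactly the last position of each block is enough, because the position
preceding a block is then always selected ([flatten_selection]).  The last
position of P is a leaf that has been counted in p and again in the number of
leaves, hence the -1 in the formula ([geodetic_number_of_decomposition]).

This argument applies to every decomposition of every reduced degree sequence,
and therefore also shows that p does not depend on them.  It remains to
produce one: a leaf is attached to each end of the path induced by the inner
vertices ([leaf_dominating_path_exists]), and the resulting word is cut
greedily ([decomposition_exists]). *)

(** * Selections in a word of reduced degrees *)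

(** The requirement on a position of reduced degree d with selection bit c,
where l and r are the bits of its two neighbours on the path: an unselected
interior vertex already has its d - 2 pendant neighbours selected.  The value
d = 1 leaves c as the only option, as a leaf must be selected. *)
Definition ok (l : bool) (d : nat) (c r : bool) : bool :=
  [|| c, 4 <= d, (d == 3) && (l || r) | [&& d == 2, l & r]].

(** The bit [prev] is that of the position preceding the word.  Beyond the end
of the word nothing counts as selected; this is harmless since the words of
interest end with a leaf. *)
Fixpoint valid (prev : bool) (w : seq (nat * bool)) : bool :=
  if w is x :: w' then
    ok prev x.1 x.2 (head false (map snd w')) && valid x.2 w'
  else true.

Lemma valid_catr p u w : valid p (u ++ w) -> valid (last p (map snd u)) w.
Proof. by elim: u p => //= x u IH p /andP[_ /IH]. Qed.

Lemma last_unselected p (u : seq (nat * bool)) :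
  0 < size u -> ~~ has snd u -> last p (map snd u) = false.
Proof.
by elim: u p => //= x [|y u] IH p _; rewrite negb_or => /andP[/negbTE-> //] /IH->.
Qed.

(** The possible ends t of the long basic sequences x gamma t. *)
Definition block_tail (t : seq nat) : bool :=
  t \in [:: [:: 1]; [:: 2]; [:: 3; 1]; [:: 3; 2]; [:: 3; 3]; [:: 3; 4]].

(** Once the position before t is unselected, t must contain a selected one: a
leaf or a 2 has to be selected itself, and a 3 needs itself or its right
neighbour. *)
Lemma tail_has_selected u r :
  block_tail (map fst u) -> valid false (u ++ r) -> has snd u.
Proof.
case: u => [|[d c] [|[d' c'] [|? u]]] //=; rewrite /block_tail !inE //=.
- rewrite !eqseq_cons !andbT !andbF !orbF.
  by case/orP=> /eqP->; rewrite /ok /= ?orbF => /andP[].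
- rewrite !eqseq_cons !andbT !andbF /= => H.
  have -> : d = 3 by case: eqP H.
  by rewrite /ok /= orbF => /andP[].
- by rewrite !eqseq_cons !andbF.
Qed.

(** The selected position is found inside the block, whatever [p] and [r] are:
in 2d the position 2 needs itself or d, and in x gamma t, if x gamma has no
selected position, then t is preceded by an unselected position of the same
block.  Disjointness of the blocks then turns this into a lower bound. *)
Lemma block_has_selected p u r :
  basic_sequence (map fst u) -> valid p (u ++ r) -> has snd u.
Proof.
case=> [|[x [gamma [t [_ _ tT]]]] def_u].
  case: u => [|[d c] [|[d' c'] [|? u]]] //=; rewrite !inE //=.
  - rewrite !eqseq_cons !andbT !andbF !orbF => /eqP->.
    by rewrite /ok /= ?orbF => /andP[].
  - rewrite !eqseq_cons !andbT !andbF /= => H.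
    have -> : d = 2 by case: eqP H.
    by rewrite /ok /=; case: c => //= /andP[/andP[_ ->]].
  - by rewrite !eqseq_cons !andbF.
pose n := (size gamma).+1.
have def_t : map fst (drop n u) = t.
  by rewrite map_drop def_u -cat_cons drop_size_cat.
have n_gt0 : 0 < size (take n u).
  rewrite size_take -(size_map fst u) def_u /= size_cat /n.
  by case: ifP; lia.
rewrite -{1 2}(cat_take_drop n u) -catA has_cat => /valid_catr.
case: (boolP (has _ _)) => //= unsel; rewrite last_unselected //.
by apply: tail_has_selected; rewrite def_t.
Qed.

Lemma flatten_leq_selected lambda p u :
    (forall l, l \in lambda -> basic_sequence l) ->
    map fst u = flatten lambda -> valid p u ->
  size lambda <= count snd u.
Proof.
elim: lambda p u => //= l lambda IH p u basic_l def_u val_u.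
have def_l : map fst (take (size l) u) = l by rewrite map_take def_u take_size_cat.
have def_r : map fst (drop (size l) u) = flatten lambda.
  by rewrite map_drop def_u drop_size_cat.
rewrite -(cat_take_drop (size l) u) in val_u *.
rewrite count_cat -add1n leq_add //.
  rewrite -has_count; apply: block_has_selected val_u.
  by rewrite def_l; apply: basic_l; rewrite mem_head.
apply: IH def_r (valid_catr val_u) => l' l'_in.
by apply: basic_l; rewrite inE l'_in orbT.
Qed.

Lemma tail_selection t r : block_tail t ->
  exists2 u, map fst u = t /\ count snd u = 1
    & forall p, valid true r -> valid p (u ++ r).
Proof.
rewrite /block_tail !inE.
have one d : exists2 u, map fst u = [:: d] /\ count snd u = 1
    & forall p, valid true r -> valid p (u ++ r).
  by exists [:: (d, true)].
have two d : exists2 u, map fst u = [:: 3; d] /\ count snd u = 1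
    & forall p, valid true r -> valid p (u ++ r).
  by exists [:: (3, false); (d, true)] => //= p ->; rewrite /ok /= !orbT.
by do 5?[case/orP=> [/eqP->|]; first by auto]; move/eqP->; auto.
Qed.

(** Selecting the last position only: the first one has a selected left
neighbour, the 4's need nothing, and a 3 in the last place but one has a
selected right neighbour.  As the block ends on a selected position, the same
can be done with the rest [r] of the word. *)
Lemma block_selection l r : basic_sequence l ->
  exists2 u, map fst u = l /\ count snd u = 1
    & valid true r -> valid true (u ++ r).
Proof.
case=> [|[x [gamma [t [x34 gamma4 tT ->]]]]].
  have two d : exists2 u, map fst u = [:: 2; d] /\ count snd u = 1
      & valid true r -> valid true (u ++ r).
    by exists [:: (2, false); (d, true)] => //= ->.
  rewrite !inE; case/orP=> [/eqP->|]; first by exists [:: (1, true)].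
  by do 3?[case/orP=> [/eqP->|]; first by auto]; move/eqP->; auto.
have [u [def_t sel_u] val_u] := tail_selection r tT.
exists ((x, false) :: map (fun d => (d, false)) gamma ++ u).
  rewrite /= map_cat -map_comp map_id def_t; split=> //.
  by rewrite add0n count_cat sel_u count_map (eq_count (a2 := pred0)) ?count_pred0.
move=> /val_u{}val_u /=; apply/andP; split.
  by move: x34; rewrite !inE => /orP[]/eqP->.
elim: gamma gamma4 false => [|d gamma IH] /=; first by move=> _ p; apply: val_u.
by move=> /andP[/eqP-> /IH{}IH] p; rewrite IH /ok /= orbT.
Qed.

Lemma flatten_selection lambda : (forall l, l \in lambda -> basic_sequence l) ->
  exists u, [/\ map fst u = flatten lambda, count snd u = size lambda & valid true u].
Proof.
elim: lambda => [|l lambda IH] basic_l; first by exists [::].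
have [l' l'_in|r [def_r sel_r val_r]] := IH.
  by apply: basic_l; rewrite inE l'_in orbT.
have [|u [def_u sel_u] val_u] := @block_selection l r.
  by apply: basic_l; rewrite mem_head.
exists (u ++ r); split; last exact: val_u.
  by rewrite map_cat def_u def_r.
by rewrite count_cat sel_u sel_r.
Qed.

(** The local form of [valid], in which a position of the word is a vertex y
together with a splitting of the path at y. *)
Lemma valid_splitP (T : Type) (d : T -> nat) (c : T -> bool) x s :
  valid (c x) [seq (d y, c y) | y <- s] <->
  forall s1 y s2, s = s1 ++ y :: s2 ->
    ok (c (last x s1)) (d y) (c y) (head false (map c s2)).
Proof.
elim: s x => [|z s IH] x /=; first by split=> // _ [].
have -> : map snd [seq (d y, c y) | y <- s] = map c s by rewrite -map_comp.
split=> [/andP[okz /IH val_s] [|z1 s1] y s2 /= [<- def_s] | H].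
- by rewrite -def_s.
- exact: val_s.
rewrite (H [::] z s) //=; apply/IH => s1 y s2 def_s.
by apply: (H (z :: s1)); rewrite def_s.
Qed.

(** * Cutting a word into basic sequences *)

(** Reading the word from the left, the letters read since the last cut are
either nothing, a 2, or x followed by 4's.  The induction therefore carries a
second statement, about words in which a block x gamma is still open. *)
Lemma decomposition_exists m : all (fun d => 2 <= d <= 4) m ->
  exists2 lambda, forall l, l \in lambda -> basic_sequence l
    & m ++ [:: 1] = flatten lambda.
Proof.
pose decomposes w := exists2 lambda, forall l, l \in lambda -> basic_sequence l
  & w = flatten lambda.
have cons_block l w : basic_sequence l -> decomposes w -> decomposes (l ++ w).
  move=> bl [lambda blambda ->]; exists (l :: lambda) => // l'.
  by rewrite inE => /predU1P[->|/blambda].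
have nil_dec : decomposes [::] by exists [::].
have long x gamma t : x \in [:: 3; 4] -> all (pred1 4) gamma -> block_tail t ->
    basic_sequence (x :: gamma ++ t).
  by move=> ? ? ?; right; exists x, gamma, t.
have two d : 0 < d <= 4 -> basic_sequence [:: 2; d].
  by case: d => [|[|[|[|[|d]]]]] // _; left.
have three d : 0 < d <= 4 -> block_tail [:: 3; d].
  by case: d => [|[|[|[|[|d]]]]].
suff main n : forall m, size m < n -> all (fun d => 2 <= d <= 4) m ->
    decomposes (m ++ [:: 1]) /\
    forall x gamma, x \in [:: 3; 4] -> all (pred1 4) gamma ->
      decomposes ((x :: gamma) ++ m ++ [:: 1]).
  by move=> /(main _ _ (leqnn _))[].
elim: n => // n IH [|d {}m] // size_m.
  split; first by exists [:: [:: 1]] => // l; rewrite inE => /eqP->; left.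
  move=> x gamma x34 g4; rewrite -[_ ++ _]cats0.
  by apply: cons_block => //; apply: long.
move=> /= /andP[/andP[d2 d4] all_m].
have {}d234 : [\/ d = 2, d = 3 | d = 4].
  by move: d d2 d4 {size_m} => [|[|[|[|[|d]]]]] // _ _; constructor.
have [dec_m open_m] := IH m size_m all_m.
(* After a 2, or after a 3 within an open block, one more letter c closes the
   block, whatever c is; this letter may be the final 1. *)
have pair_tail : exists c w, [/\ 0 < c <= 4, m ++ [:: 1] = c :: w & decomposes w].
  case: m size_m all_m {dec_m open_m} => [|c m] /= size_m; first by exists 1, [::].
  case/andP=> /andP[c2 c4] /(IH m (ltnW size_m))[dec_m _].
  by exists c, (m ++ [:: 1]); rewrite c4 (ltnW c2).
have [c [w [c_bound def_w dec_w]]] := pair_tail.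
split=> [|x gamma x34 g4].
- case: d234 => ->; last 2 first.
  + exact: (open_m 3 [::]).
  + exact: (open_m 4 [::]).
  by rewrite def_w; apply: (cons_block [:: 2; c]) => //; apply: two.
- case: d234 => ->.
  + have := cons_block (x :: gamma ++ [:: 2]) (m ++ [:: 1]).
    by rewrite /= -catA; apply=> //; apply: long.
  + have := cons_block (x :: gamma ++ [:: 3; c]) w.
    by rewrite /= -catA def_w; apply=> //; apply: long => //; apply: three.
  + have := open_m x (gamma ++ [:: 4]).
    by rewrite /= -catA all_cat g4; apply.
Qed.

(** * Dominating paths in acyclic graphs *)

Section Graph.
Variables (V : finType) (e : rel V).
Hypotheses (e_sym : symmetric e) (e_irr : irreflexive e).

Let N (v : V) : {set V} := [set u | e v u].

Lemma leaves_sub_geodetic S : P3_geodetic e S -> leaves e \subset S.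
Proof.
move=> /forallP geoS; apply/subsetP=> v; rewrite inE => /eqP deg_v.
apply: contraLR (geoS v) => vS; rewrite vS /= -ltnNge ltnS -deg_v.
by apply/subset_leq_card/subsetP=> u; rewrite !inE => /andP[].
Qed.

(** Counting the neighbours missing from S suits the path better than counting
those in S, as they all lie on it. *)
Lemma geodeticE S :
  P3_geodetic e S = [forall v, (v \notin S) ==> (2 + #|N v :\: S| <= deg e v)].
Proof.
apply: eq_forallb => v; congr (_ ==> _).
rewrite /deg -/(N v) -(cardsID S (N v)) leq_add2r.
by congr (_ <= #|pred_of_set _|); apply/setP=> u; rewrite !inE andbC.
Qed.

Lemma geodetic_number_eq n :
    (exists2 S, P3_geodetic e S & #|S| = n) ->
    (forall S, P3_geodetic e S -> n <= #|S|) ->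
  P3_geodetic_number e = n.
Proof.
move=> [S geoS cardS] lbn; rewrite /P3_geodetic_number.
case: arg_minnP => [|M geoM minM].
  by apply/forallP=> v; rewrite inE.
by apply/eqP; rewrite eqn_leq lbn // -cardS minM.
Qed.

Lemma card_off_path (s : seq V) (A : {set V}) : uniq s ->
    (forall x, x \notin s -> x \in A) ->
  #|A| = #|~: [set x in s]| + count (mem A) s.
Proof.
move=> s_uniq offA; rewrite -(cardsID [set x in s] A) addnC; congr (_ + _).
  apply: eq_card => x; rewrite !inE.
  by case: (boolP (x \in s)) => //= /offA.
rewrite -size_filter -(card_uniqP (filter_uniq _ s_uniq)).
by apply: eq_card => x; rewrite !inE mem_filter.
Qed.

Section Acyclic.
Hypothesis acyclic : forall c : seq V, ucycle e c -> size c < 3.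

(** In an acyclic graph, two neighbours of u cannot be joined within a set
avoiding u: a simple path between them would close to a cycle through u. *)
Lemma no_detour (A : pred V) u x y : u \notin A -> e u x -> e u y -> x != y ->
  x \in A -> ~~ connect [rel a b | [&& e a b, a \in A & b \in A]] x y.
Proof.
move=> uA ux uy xy xA; apply/negP=> /connectP[p0 p0_path y_last].
move: y_last; case/shortenP: p0_path => p p_path p_uniq _ y_last.
have pA : all (mem A) p.
  by elim: p x {xA ux xy p_uniq y_last} p_path => //= z p IH x
    /andP[/and3P[_ _ ->] /IH].
have := acyclic (c := u :: x :: p); rewrite /ucycle.
rewrite /= rcons_path ux -y_last e_sym uy andbT.
have -> : path e x p by apply: sub_path p_path => a b /and3P[].
have -> : u \notin x :: p.
  apply: contra uA; rewrite inE => /predU1P[->|] //.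
  by move/allP: pA; apply.
rewrite /= in p_uniq; rewrite p_uniq => /(_ isT).
by case: p y_last {p_path p_uniq pA} => //= y_last; rewrite y_last eqxx in xy.
Qed.

Lemma connect_path (A : pred V) x p y : path e x p -> y \in x :: p ->
    {subset x :: p <= A} ->
  connect [rel a b | [&& e a b, a \in A & b \in A]] x y.
Proof.
elim: p x => [|z p IH] x /=; first by rewrite inE => _ /eqP->.
move=> /andP[xz z_path]; rewrite inE => /predU1P[-> //|y_in] subA.
have subA' : {subset z :: p <= A} by move=> t t_in; apply: subA; rewrite inE t_in orbT.
apply: connect_trans (IH _ z_path y_in subA'); apply: connect1.
by rewrite /= xz subA ?mem_head // subA' ?mem_head.
Qed.

(** By [no_detour] in the part of the path after u: it joins the successor z of
u to y. *)
Lemma path_no_chord s1 u z s2 y : sorted e (s1 ++ u :: z :: s2) ->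
  uniq (s1 ++ u :: z :: s2) -> y \in s2 -> ~~ e u y.
Proof.
rewrite cat_uniq => /cat_sorted2[_ /=/andP[uz z_path]] /and3P[_ _].
move=> /= /and3P[u_notin z_notin _] y_in; apply/negP => uy.
have yz : z != y by apply: contraNneq z_notin => ->.
have := no_detour (A := mem (z :: s2)) u_notin uz uy yz (mem_head _ _).
by rewrite (connect_path z_path) // inE y_in orbT.
Qed.

Variables (v : V) (P : seq V).
Hypothesis ldp : leaf_dominating_path e v P.

Let v_path : path e v P. Proof. by case: ldp => /andP[]. Qed.
Let vP_uniq : uniq (v :: P). Proof. by case: ldp => /andP[]. Qed.

Lemma connect_on_path (A : pred V) x y : {subset v :: P <= A} ->
  x \in v :: P -> y \in v :: P ->
  connect [rel a b | [&& e a b, a \in A & b \in A]] x y.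
Proof.
move=> subA x_in y_in; apply: connect_trans (connect_path v_path y_in subA).
rewrite sym_connect_sym; first exact: connect_path v_path x_in subA.
by move=> a b /=; rewrite e_sym [(a \in A) && _]andbC.
Qed.

(** By domination u has a neighbour x on the path.  Another neighbour y is on
the path, or adjacent to a vertex of it, so that y is joined to x without
passing through u, against [no_detour]. *)
Lemma off_path_leaf u : u \notin v :: P -> u \in leaves e.
Proof.
move=> u_off; have [_ _ _ _ dom] := ldp; have [x x_on ux] := dom u u_off.
rewrite inE; apply/cards1P; exists x; apply/setP=> y; rewrite !inE.
apply/idP/eqP=> [uy|-> //]; apply/eqP; apply: contraT => yx.
case: (boolP (y \in v :: P)) => y_on.
  have xy : x != y by rewrite eq_sym.
  have := no_detour (A := mem (v :: P)) u_off ux uy xy x_on.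
  by rewrite connect_on_path.
have [z z_on yz] := dom y y_on.
have u_off' : u \notin predU1 y (mem (v :: P)).
  rewrite -topredE /= negb_or u_off andbT.
  by apply: contraTneq uy => ->; rewrite e_irr.
have sub : {subset v :: P <= predU1 y (mem (v :: P))}.
  by move=> t t_in; rewrite -topredE /= t_in orbT.
have := no_detour u_off' uy ux yx _.
have y_in : y \in predU1 y (mem (v :: P)) by rewrite -topredE /= eqxx.
move/(_ y_in); rewrite (connect_trans _ (connect_on_path sub z_on x_on)) //.
by apply: connect1; rewrite /= yz y_in sub.
Qed.

Section Split.
(* A vertex y of P which is not its last one: its neighbours on the path are
   z and the vertex [last v s1], which is v itself when s1 is empty. *)
Variables (s1 : seq V) (y z : V) (s2 : seq V).
Hypothesis def_P : P = s1 ++ y :: z :: s2.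

Lemma interior_neighbours : [/\ e y (last v s1), e y z & last v s1 != z].
Proof.
move: v_path vP_uniq; rewrite def_P cat_path -cat_cons cat_uniq.
move=> /and4P[_ e1 e2 _] /and3P[_ disj _]; split=> //; first by rewrite e_sym.
apply: contra disj => /eqP lz; apply/hasP; exists z; first by rewrite !inE eqxx orbT.
by rewrite -lz; apply: mem_last.
Qed.

Lemma interior_deg_ge2 : 2 <= deg e y.
Proof.
have [e1 e2 nz] := interior_neighbours.
have <- : #|[set last v s1; z]| = 2 by rewrite cards2 nz.
apply/subset_leq_card/subsetP=> x; rewrite !inE.
by case/orP=> /eqP->.
Qed.

Lemma interior_neighbour_on_path x :
  x \in v :: P -> e y x -> x = last v s1 \/ x = z.
Proof.
have vP_sorted : sorted e (v :: P) by [].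
move: vP_sorted vP_uniq; rewrite def_P -cat_cons => vPs vPu.
rewrite mem_cat => /orP[x_in|]; last rewrite inE => /predU1P[->|];
  last rewrite inE => /predU1P[->|x_in]; move=> yx.
- rewrite lastI mem_rcons inE in x_in; case/predU1P: x_in => [->|x_in]; first by left.
  rewrite lastI cat_rcons in vPs vPu.
  case/splitPr: x_in vPs vPu => t1 [|a t2]; rewrite -catA /= => vPs vPu.
    by have := path_no_chord vPs vPu (mem_head _ _); rewrite e_sym yx.
  have y_in : y \in t2 ++ [:: last v s1, y, z & s2] by rewrite mem_cat !inE eqxx !orbT.
  by have := path_no_chord vPs vPu y_in; rewrite e_sym yx.
- by rewrite e_irr in yx.
- by right.
- by have := path_no_chord vPs vPu x_in; rewrite yx.
Qed.

(** The last term counts the neighbours off the path that S misses. *)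
Lemma unselected_neighbours (S : {set V}) :
  #|N y :\: S| = (last v s1 \notin S) + (z \notin S)
                 + #|(N y :\: S) :\ last v s1 :\ z|.
Proof.
have [e1 e2 nz] := interior_neighbours.
rewrite (cardsD1 (last v s1)) (cardsD1 z) !inE e1 e2 eq_sym nz !andbT.
by rewrite addnA.
Qed.

End Split.

Lemma leaf_dominating_path_ends :
  exists Q w, [/\ P = rcons Q w, v \in leaves e & w \in leaves e].
Proof.
case: ldp => _; case/lastP: P => // Q w _ v_leaf.
by rewrite last_rcons => w_leaf _; exists Q, w.
Qed.

Lemma interior_split Q w y : P = rcons Q w -> y \in Q ->
  exists s1 z s2, P = s1 ++ y :: z :: s2.
Proof.
move=> -> /path.splitPr[s1 [|z s2]].
  by exists s1, w, [::]; rewrite rcons_cat.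
by exists s1, z, (rcons s2 w); rewrite rcons_cat.
Qed.

Lemma count_leaves_on_path : count (mem (leaves e)) (v :: P) = 2.
Proof.
have [Q [w [def_P v_leaf w_leaf]]] := leaf_dominating_path_ends.
rewrite def_P /= -cats1 count_cat /= v_leaf w_leaf !addn0.
rewrite (@eq_in_count _ _ pred0) ?count_pred0 // => y y_in /=.
have [s1 [z [s2 def_P']]] := interior_split def_P y_in.
have := interior_deg_ge2 def_P'; rewrite inE.
by case: eqP => // ->.
Qed.

Lemma reduced_degrees_shape : exists2 m,
  all (fun d => 2 <= d <= 4) m & [seq minn (deg e x) 4 | x <- P] = m ++ [:: 1].
Proof.
have [Q [w [def_P v_leaf w_leaf]]] := leaf_dominating_path_ends.
exists [seq minn (deg e x) 4 | x <- Q]; last first.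
  by rewrite def_P map_rcons -cats1; move: w_leaf; rewrite inE => /eqP->.
apply/allP=> _ /mapP[y y_in ->].
have [s1 [z [s2 def_P']]] := interior_split def_P y_in.
by rewrite leq_min (interior_deg_ge2 def_P') geq_minr.
Qed.

Let word (S : {set V}) := [seq (minn (deg e y) 4, y \in S) | y <- P].

Lemma last_leaf s1 y : P = s1 ++ [:: y] -> y \in leaves e.
Proof. by case: ldp => _ _ _ w_leaf _ def_P; rewrite def_P last_cat in w_leaf. Qed.

(** Only the two path neighbours of y are used: y misses at most deg y - 2
neighbours in S, hence none if its degree is 2 and one if it is 3. *)
Lemma geodetic_valid S : P3_geodetic e S -> valid (v \in S) (word S).
Proof.
move=> geoS; have /subsetP leafS := leaves_sub_geodetic geoS.
apply/(valid_splitP (fun y => minn (deg e y) 4) (fun y => y \in S)).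
move=> s1 y [|z s2] def_P.
  by rewrite (leafS y (last_leaf def_P)).
rewrite /ok /=; case: (boolP (y \in S)) => //= yS.
move: geoS; rewrite geodeticE => /forallP/(_ y); rewrite yS /=.
rewrite (unselected_neighbours def_P).
case: (last v s1 \in S); case: (z \in S);
  by case: (deg e y) => [|[|[|[|d]]]] //; rewrite minnC /minn.
Qed.

(** Here the absence of chords matters: every neighbour of y other than its two
path neighbours is off the path, hence in S. *)
Lemma valid_geodetic (S : {set V}) : (forall x, x \notin P -> x \in S) ->
  valid (v \in S) (word S) -> P3_geodetic e S.
Proof.
move=> offS /(valid_splitP (fun y => minn (deg e y) 4) (fun y => y \in S)) okS.
rewrite geodeticE; apply/forallP=> y; apply/implyP=> yS.
have y_in : y \in P by apply: contraR yS => /offS.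
have [s1 [s2 def_P]] : exists s1 s2, P = s1 ++ y :: s2.
  by case/path.splitPr: y_in => s1 s2; exists s1, s2.
move: (okS _ _ _ def_P); rewrite (negbTE yS) /ok /=.
case: s2 def_P => [|z s2] def_P.
  by have := last_leaf def_P; rewrite inE => /eqP->.
rewrite (unselected_neighbours def_P).
have -> : (N y :\: S) :\ last v s1 :\ z = set0.
  apply/setP=> x; rewrite !inE; apply: negbTE; apply/and4P=> -[xz xl xS yx].
  have x_on : x \in v :: P by rewrite inE; apply/orP; right; apply: contraR xS => /offS.
  by case: (interior_neighbour_on_path def_P x_on yx) => /eqP; apply/negP.
rewrite cards0 /=; case: (last v s1 \in S); case: (z \in S);
  by case: (deg e y) => [|[|[|[|d]]]] //; rewrite minnC /minn.
Qed.

(** Outside of v :: P both sets consist of all vertices; on v :: P there are two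
leaves, whereas A has v and the elements of P that it selects. *)
Lemma card_leaves_selected (A : {set V}) : leaves e \subset A ->
  #|A|.+1 = #|leaves e| + count (mem A) P.
Proof.
move=> /subsetP leafA; have off x : x \notin v :: P -> x \in A.
  by move/off_path_leaf/leafA.
rewrite (card_off_path vP_uniq off) (card_off_path vP_uniq off_path_leaf).
rewrite count_leaves_on_path /=.
have -> : v \in A by apply: leafA; case: ldp.
by rewrite add1n addnS addn2.
Qed.

(** The selection bits of a word are carried back to a set of vertices through
the position of each vertex in P, which is well defined as P has no repetition. *)
Lemma selection_of_word u : map fst u = [seq minn (deg e y) 4 | y <- P] ->
  exists2 S : {set V}, (forall x, x \notin P -> x \in S) & word S = u.
Proof.
move=> def_u; have size_u : size u = size P.
  by rewrite -(size_map fst u) def_u size_map.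
exists (~: [set x in P | ~~ (nth (0, false) u (index x P)).2]).
  by move=> x xP; rewrite !inE negb_and xP.
apply: (@eq_from_nth _ (0, false)); first by rewrite size_map size_u.
move=> i; rewrite size_map => i_lt; rewrite (nth_map v) // !inE.
have /=/andP[_ P_uniq] := vP_uniq.
rewrite mem_nth // index_uniq // negbK.
rewrite -(nth_map v 0 (fun y => minn (deg e y) 4)) // -def_u.
by rewrite (nth_map (0, false)) ?size_u // -surjective_pairing.
Qed.

Lemma geodetic_number_of_decomposition lambda :
    (forall l, l \in lambda -> basic_sequence l) ->
    [seq minn (deg e y) 4 | y <- P] = flatten lambda ->
  P3_geodetic_number e = size lambda + #|leaves e| - 1.
Proof.
move=> basic_l def_w.
have count_word S : count snd (word S) = count (mem S) P by rewrite count_map.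
have fst_word S : map fst (word S) = flatten lambda by rewrite -def_w -map_comp.
apply: geodetic_number_eq => [|S geoS]; last first.
  have := flatten_leq_selected basic_l (fst_word S) (geodetic_valid geoS).
  by have := card_leaves_selected (leaves_sub_geodetic geoS); rewrite count_word; lia.
have [u [def_u sel_u val_u]] := flatten_selection basic_l.
have [|S offS def_S] := @selection_of_word u; first by rewrite def_u.
have geoS : P3_geodetic e S.
  apply: valid_geodetic => //; rewrite def_S offS //.
  by have /=/andP[] := vP_uniq.
exists S => //; have := card_leaves_selected (leaves_sub_geodetic geoS).
by rewrite -count_word def_S sel_u; lia.
Qed.

End Acyclic.

(** * Existence of a leaf dominating path *)

Section Existence.
Hypothesis connected : forall x y : V, connect e x y.

Lemma leaf_neighbour_unique u x y : u \in leaves e -> e u x -> e u y -> x = y.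
Proof.
rewrite inE => /cards1P[a /setP Nu] ux uy.
by have:= Nu x; have := Nu y; rewrite !inE ux uy => /esym/eqP-> /esym/eqP->.
Qed.

(** Two adjacent leaves form a connected component. *)
Lemma adjacent_leaves u w x :
  u \in leaves e -> w \in leaves e -> e u w -> x \in [:: u; w].
Proof.
move=> u_leaf w_leaf uw; have /connectP[p] := connected u x.
have: u \in [:: u; w] by apply: mem_head.
elim: p {1 3 4}u => [|b p IH] a /= a_in; first by move=> _ ->.
case/andP=> ab b_path def_x; apply: IH b_path def_x.
move: a_in; rewrite !inE => /orP[]/eqP a_eq; rewrite a_eq in ab.
- by rewrite (leaf_neighbour_unique u_leaf ab uw) eqxx orbT.
- by rewrite e_sym in uw; rewrite (leaf_neighbour_unique w_leaf ab uw) eqxx.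
Qed.

Hypothesis V_ge2 : 2 <= #|V|.

Lemma neighbour_exists x : exists y, e x y.
Proof.
have [y yx] : exists y, y != x.
  have : 0 < #|predC1 x| by rewrite cardC1 -subn1 subn_gt0.
  by case/card_gt0P=> y; rewrite inE; exists y.
have /connectP[[|z p] /= xp def_y] := connected x y; first by rewrite def_y eqxx in yx.
by exists z; case/andP: xp.
Qed.

(** An end of the spine has a single inner neighbour z.  The same lemma provides
a second leaf at the only vertex of a one-vertex spine: then z is the first
leaf, and there is no inner neighbour at all. *)
Lemma other_leaf_neighbour a z : a \notin leaves e ->
    (forall y, e a y -> y \notin leaves e -> y = z) ->
  exists x, [/\ e a x, x \in leaves e & x != z].
Proof.
move=> a_int only_z; have [b ab] := neighbour_exists a.
have deg_a : 1 < deg e a.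
  have : 0 < deg e a by apply/card_gt0P; exists b; rewrite inE.
  by move: a_int; rewrite inE; case: (deg e a) => [|[]].
have : 0 < #|N a :\ z|.
  by move: deg_a; rewrite /deg -/(N a) (cardsD1 z); case: (z \in N a) => //; apply: ltnW.
case/card_gt0P=> x; rewrite !inE => /andP[xz ax]; exists x; split=> //.
by apply: contraR xz => /(only_z x ax)/eqP.
Qed.

(** A leaf is added at each end of the spine q.  A remaining leaf has a neighbour
in q, since two adjacent leaves would be the whole graph.  When q is empty the
graph is a single edge. *)
Lemma leaf_dominating_path_exists : induces_path e (~: leaves e) ->
  exists v P, leaf_dominating_path e v P.
Proof.
case=> q [q_uniq q_int q_adj].
have int_q x : (x \in q) = (x \notin leaves e) by rewrite q_int inE.
case: q q_uniq int_q q_adj {q_int} => [|a q] q_uniq int_q q_adj.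
  have [v _] : exists v, v \in V by apply/card_gt0P; apply: ltnW.
  have all_leaves x : x \in leaves e by rewrite -[_ \in _]negbK -int_q.
  have [w vw] := neighbour_exists v.
  exists v, [:: w]; split=> //=; rewrite ?vw ?inE /=.
    by rewrite andbT; apply: contraTneq vw => ->; rewrite e_irr.
  move=> x; rewrite (adjacent_leaves x (all_leaves v) (all_leaves w) vw).
  by [].
have {}q_adj : {in a :: q &, forall x y, e x y =
    (index y (a :: q) == (index x (a :: q)).+1)
    || (index x (a :: q) == (index y (a :: q)).+1)}.
  by move=> x y xq yq; apply: q_adj; rewrite in_setC -int_q.
set b := last a q.
have b_in : b \in a :: q by apply: mem_last.
have q_path : path e a q.
  apply/(pathP a) => i i_lt.
  have i_lt' : i < size (a :: q) by apply: ltnW.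
  rewrite -[nth a q i]/(nth a (a :: q) i.+1).
  by rewrite q_adj ?mem_nth // !index_uniq ?eqxx.
(* For a spine with at least two vertices the leaves at its ends a and b differ
   because a leaf has only one neighbour. *)
have [x [y [ax yb x_leaf y_leaf xy]]] : exists x y,
    [/\ e a x, e b y, x \in leaves e, y \in leaves e & x != y].
  have a_int : a \notin leaves e by rewrite -int_q mem_head.
  have b_int : b \notin leaves e by rewrite -int_q.
  have adj_a t : e a t -> t \notin leaves e -> index t (a :: q) = 1.
    move=> at_ t_int; move: at_; rewrite q_adj ?mem_head ?int_q //= eqxx.
    by case/orP=> /eqP.
  have adj_b t : e b t -> t \notin leaves e -> index t (a :: q) = (size q).-1 /\ 0 < size q.
    move=> bt t_int; move: bt; rewrite q_adj ?int_q // /b index_last //.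
    have : index t (a :: q) < (size q).+1 by rewrite (index_mem t (a :: q)) int_q.
    move: (index _ _) => i i_lt /orP[]/eqP def_i; last by rewrite def_i.
    by rewrite def_i ltnn in i_lt.
  have [q0|q_gt0] := posnP (size q).
    have [t at_ t_int|x [ax x_leaf _]] := other_leaf_neighbour (z := a) a_int.
      by have ind := adj_a t at_ t_int; have := index_mem t (a :: q); rewrite ind int_q t_int /= q0.
    have [t bt t_int|y [yb y_leaf yx]] := other_leaf_neighbour (z := x) b_int.
      by have [] := adj_b t bt t_int; rewrite q0.
    by exists x, y; split=> //; rewrite eq_sym.
  have at_index t i : t \notin leaves e -> index t (a :: q) = i -> t = nth a (a :: q) i.
    by move=> t_int <-; rewrite nth_index // int_q.
  have [t at_ t_int|x [ax x_leaf _]] := other_leaf_neighbour (z := nth a (a :: q) 1) a_int.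
    exact: at_index t_int (adj_a t at_ t_int).
  have [t bt t_int|y [yb y_leaf _]] :=
      other_leaf_neighbour (z := nth a (a :: q) (size q).-1) b_int.
    exact: at_index t_int (adj_b t bt t_int).1.
  exists x, y; split=> //.
  have ab : a != b.
    apply: contraTneq q_uniq; rewrite /b; case: (q) q_gt0 => //= c q' _ ->.
    by rewrite mem_last.
  apply: contraNneq ab => xy; rewrite e_sym in ax; rewrite -xy e_sym in yb.
  by rewrite (leaf_neighbour_unique x_leaf ax yb).
have off_q t : t \in leaves e -> t \notin a :: q by rewrite int_q negbK.
exists x, (rcons (a :: q) y); split=> //.
- rewrite rcons_path [path _ _ _]/= e_sym ax q_path yb.
  rewrite -rcons_cons rcons_uniq inE negb_or eq_sym xy (off_q _ y_leaf).
  by rewrite [uniq _]/= (off_q _ x_leaf).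
- by rewrite last_rcons.
move=> t; rewrite inE negb_or mem_rcons inE negb_or => /and3P[tx ty t_off].
have t_leaf : t \in leaves e by apply: contraR t_off; rewrite -int_q.
have [u tu] := neighbour_exists t; exists u => //.
rewrite inE mem_rcons inE int_q.
case: (boolP (u \in leaves e)) => [u_leaf|]; last by rewrite !orbT.
have := adjacent_leaves a t_leaf u_leaf tu; rewrite !inE.
have a_int : a \notin leaves e by rewrite -int_q mem_head.
by case/orP=> /eqP a_eq; rewrite a_eq ?t_leaf ?u_leaf in a_int.
Qed.

End Existence.
End Graph.

(** * The formula *)

Theorem theorem1 (V : finType) (e : rel V)
    (e_sym : symmetric e) (e_irr : irreflexive e)
    (T_caterpillar : caterpillar e) (V_ge2 : 2 <= #|V|) :
  P3_geodetic_number e = basic_sequence_number e + #|leaves e| - 1.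
Proof.
have [[_ connected acyclic] spine] := T_caterpillar.
have formula s lambda : reduced_degree_sequence e s -> basic_decomposition s lambda ->
    P3_geodetic_number e = size lambda + #|leaves e| - 1.
  move=> [v [P [ldp ->]]] [basic_l [_ def_w]].
  exact: geodetic_number_of_decomposition ldp _ basic_l def_w.
have [v [P ldp]] := leaf_dominating_path_exists e_sym e_irr connected V_ge2 spine.
have v_leaf : v \in leaves e by case: ldp.
have [m m234 def_m] := reduced_degrees_shape e_sym ldp.
have [lambda basic_l def_l] := decomposition_exists m234.
pose s := [seq minn (deg e x) 4 | x <- v :: P].
have red_s : reduced_degree_sequence e s by exists v, P.
have dec_s : basic_decomposition s lambda.
  split=> //; rewrite /s /= def_m def_l.
  by move: v_leaf; rewrite inE => /eqP->.
rewrite (formula _ _ red_s dec_s) (@basic_sequence_number_eq _ _ (size lambda)) //.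
split=> [|s' lambda' red_s' dec_s']; first by exists s, lambda.
have : 0 < #|leaves e| by apply/card_gt0P; exists v.
have := formula _ _ red_s dec_s; rewrite (formula _ _ red_s' dec_s').
by case: #|leaves e| => // l; rewrite !addnS !subn1 => /addIn.
Qed.
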